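(* There exist an absolute constant $C$, a labeling scheme, and a deterministic distributed algorithm using its labels such that, for every $k\ge 1$ and every instance of $k$-gathering on a radio network with diameter $D$ and maximum degree $\Delta\geq 1$, the labeling scheme has length at most $C\,(1+\min(\log\Delta,\log k))$ on this instance and the algorithm accomplishes $k$-gathering in at most $C\min(D+k,\,D\Delta)$ rounds. This label length is asymptotically optimal: there is an absolute constant $c>0$ such that for all $k\ge 1$ and $\Delta\ge 2$ there is an instance of $k$-gathering on a network of maximum degree $\Delta$ on which every labeling scheme permitting some deterministic distributed algorithm to accomplish $k$-gathering has length at least $c\min(\log\Delta,\log k)$.
   Context: Radio network: a finite simple undirected connected graph $G=(V,E)$. Computation proceeds in synchronous rounds. In each round every node either transmits a message to all its neighbors or listens. A node $v$ receives the message of a neighbor $w$ in a round iff $v$ listens in this round and $w$ is the only neighbor of $v$ transmitting in this round; otherwise $v$ receives nothing, and cannot tell whether any neighbor transmitted. There is no bound on message size, so several source messages may be combined in one transmission. $k$-gathering: an instance is a network with $k$ distinct nodes $s_1,\dots,s_k$ (sources), each holding a message, and a node $s$ (sink). All $k$ messages must reach $s$. Labeling scheme: assigns to each node of each instance a binary string (its label), possibly depending on the whole instance; labels need not be distinct. Its length is the maximum length of an assigned label. In a deterministic distributed algorithm all nodes run the same algorithm (the same for all instances); initially a node knows only its own label and, if it is a source, its message. Nodes know nothing else about the network. Source messages are opaque: the decision whether to transmit depends only on the label, on whether the node is a source, and on the history of receptions, and not on the contents of source messages. Non-spontaneous wake-up: only the sources start at round $0$; any other node joins only after receiving a message. The current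 round number may be attached to every message, so a node that has been woken up knows the global round number. All logarithms are to base 2. *)

(* Defs.v *)
From mathcomp Require Import all_boot all_order all_algebra.
From mathcomp Require Import reals exp.

Set Implicit Arguments.
Unset Strict Implicit.
Unset Printing Implicit Defensive.

Import Order.TTheory GRing.Theory Num.Theory.

Record network := Network {
  node : finType;
  adj : rel node;
  adj_sym : symmetric adj;
  adj_irr : irreflexive adj;
  adj_connected : forall x y : node, connect adj x y }.

Definition degree (G : network) (v : node G) : nat := #|[set w | adj v w]|.

Definition max_degree (G : network) : nat := \max_(v : node G) degree v.

(* The least length of a walk from x to y. The search may stop at #|node G|
   because G is connected. *)
Definition distance (G : network) (x y : node G) : nat :=
  find (fun n => [exists p : n.-tuple (node G),
                    path (@adj G) x p && (last x p == y)])
       (iota 0 #|node G|).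

Definition diameter (G : network) : nat :=
  \max_(x : node G) \max_(y : node G) distance x y.

(* The sink is an arbitrary node; it may be one of the sources. *)
Record gathering (k : nat) := Gathering {
  net :> network;
  source : 'I_k -> node net;
  source_inj : injective source;
  sink : node net }.

Definition is_source k (I : gathering k) (v : node I) : bool :=
  v \in codom (@source k I).

Definition labeling_scheme := forall k (I : gathering k), node I -> bitseq.

Definition label_length (G : network) (lab : node G -> bitseq) : nat :=
  \max_(v : node G) size (lab v).

(* A transmission consists of an arbitrary bit string, computed by the
   algorithm, together with a list of source messages. Source messages are
   opaque: what an algorithm observes in one round is None when nothing is
   received, and otherwise the bit string and only the number of source
   messages that come with it. *)
Definition observation := option (bitseq * nat).

(* Transmit c js sends the bit string c together with the source messages at
   the positions js of the list of source messages held by the node; positions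
   beyond the end of that list are ignored. *)
Inductive action := Listen | Transmit of bitseq & seq nat.

(* The arguments are the label, whether the node is a source, and the
   observations made in all rounds so far, oldest first. The list starts at
   round 0, so that its size is the current global round number: the algorithm
   is only consulted at nodes that are awake, and these know it. *)
Definition algorithm := bitseq -> bool -> seq observation -> action.

(* The source messages are identified with their indices in 'I_k. The list
   [held] starts with the node's own message, if any, and continues with the
   received ones in order of reception (possibly with repetitions). *)
Record state (k : nat) := State {
  history : seq observation;
  held : seq 'I_k }.

Section Execution.
Variables (k : nat) (I : gathering k).
Variables (A : algorithm) (lab : node I -> bitseq).

Definition initial (v : node I) : state k :=
  State [::] [seq i <- enum 'I_k | source I i == v].

Definition awake (v : node I) (s : state k) : bool :=
  is_source v || has isSome (history s).

(* None stands for listening. *)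
Definition transmission (v : node I) (s : state k) :
    option (bitseq * seq 'I_k) :=
  if awake v s then
    match A (lab v) (is_source v) (history s) with
    | Listen => None
    | Transmit c js => Some (c, pmap (onth (held s)) js)
    end
  else None.

Definition reception (sent : node I -> option (bitseq * seq 'I_k))
    (v : node I) : option (bitseq * seq 'I_k) :=
  if sent v is Some _ then None
  else if [pick w | [set u | adj v u & isSome (sent u)] == [set w]] is Some w
  then sent w else None.

Definition step (conf : node I -> state k) (v : node I) : state k :=
  let r := reception (fun w => transmission w (conf w)) v in
  State (rcons (history (conf v)) (omap (fun m => (m.1, size m.2)) r))
        (held (conf v) ++ oapp snd [::] r).

Definition run (t : nat) : node I -> state k := iter t step initial.

Definition gathers_in (t : nat) : Prop :=
  forall i : 'I_k, i \in held (run t (sink I)).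

End Execution.

Definition log2 (R : realType) (n : nat) : R := (ln (n%:R : R) / ln (2%:R : R))%R.

(* Main.v *)
Require Import Defs.
From mathcomp Require Import all_boot all_order all_algebra perm.
From mathcomp Require Import boolp reals exp zify.

Set Implicit Arguments.
Unset Strict Implicit.
Unset Printing Implicit Defensive.

Import Order.TTheory GRing.Theory Num.Theory.

(* Upper bound. In the BFS tree towards the sink, parents and slots below
   Delta are chosen so that nodes of one layer and one slot never disturb each
   other's parents. A node transmits only once, after all its children on the
   paths from the sources, so messages are combined on the way. Each layer is
   a queue that is never idle while a node waits and that serves, first come
   first served, all waiting nodes of one slot simultaneously. A node then
   waits less than min(Delta, k) service times, which yields the D Delta bound
   layer by layer; and since a queue that is never idle loses one node per
   service time, the delays of different layers do not add up, which yields
   the bound D + k. The label of a node only has to tell how many receptions,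
   O(min(Delta, k)), and then how many silent rounds, O(min(Delta, k)), precede
   its transmission.

   Lower bound. An involution of the network that preserves sources and labels
   preserves the whole execution, so the sink never hears a neighbor that the
   involution moves. Hence source leaves of the sink need distinct labels, and
   on a cycle through the sink the labels cannot all be equal. *)

(** * Distances, slots and queues *)

Lemma distanceP (G : network) (x y : node G) :
  exists2 p, path (@adj G) x p & last x p = y /\ size p = distance x y.
Proof.
pose a n := [exists p : n.-tuple (node G), path (@adj G) x p && (last x p == y)].
(* A path without repeated nodes has fewer than [#|node G|] edges, so the bounded search in
   [distance] succeeds. *)
have Ha : has a (iota 0 #|node G|).
  case/connectP: (adj_connected x y) => p0 Hp0 Hy.
  move: Hy; case/shortenP: Hp0 => p Hp Up _ Hy.
  apply/hasP; exists (size p).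
    rewrite mem_iota /= add0n.
    by rewrite -[_ < _]/(size (x :: p) <= _) -(card_uniqP Up) max_card.
  by apply/existsP; exists (in_tuple p); rewrite /= Hp Hy eqxx.
have := nth_find 0 Ha.
rewrite nth_iota -?[find _ _]/(distance x y); last first.
  by rewrite has_find size_iota in Ha.
rewrite add0n => /existsP[p /andP[Hp /eqP Hl]].
by exists p => //; rewrite size_tuple.
Qed.

Lemma distance_le (G : network) (x : node G) p :
  path (@adj G) x p -> distance x (last x p) <= size p.
Proof.
move=> Hp; rewrite leqNgt; apply/negP => Hlt.
pose a n := [exists q : n.-tuple (node G),
  path (@adj G) x q && (last x q == last x p)].
have := before_find 0 (Hlt : size p < find a (iota 0 #|node G|)).
rewrite nth_iota; last first.
  by apply: leq_trans Hlt _; rewrite -[leqRHS](size_iota 0) find_size.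
rewrite add0n => /negbT/negP; apply; rewrite /a; apply/existsP; exists (in_tuple p).
by rewrite /= Hp eqxx.
Qed.

Lemma distance_eq0 (G : network) (x y : node G) : (distance x y == 0) = (x == y).
Proof.
apply/eqP/eqP => [H|->].
  by have [p _ []] := distanceP x y; rewrite H; case: p.
by apply/eqP; rewrite -leqn0; apply: (distance_le (p := [::])).
Qed.

Lemma distance_adj (G : network) (x y z : node G) :
  adj y z -> distance x z <= (distance x y).+1.
Proof.
move=> Hyz; have [p Hp [Hl <-]] := distanceP x y.
have := @distance_le G x (rcons p z); rewrite rcons_path Hp Hl last_rcons size_rcons.
exact.
Qed.

Lemma distance_pred (G : network) (x y : node G) :
  0 < distance x y -> exists2 z, adj y z & (distance x z).+1 = distance x y.
Proof.
have [p] := distanceP x y; case/lastP: p => [|p w] /=.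
  by move=> _ [_ <-].
rewrite rcons_path last_rcons size_rcons => /andP[Hp Ha] [Hw Hs] _; subst w.
exists (last x p); first by rewrite adj_sym.
have := distance_le Hp; have := distance_adj x Ha; lia.
Qed.

Lemma distance_le_diameter (G : network) (x y : node G) : distance x y <= diameter G.
Proof.
apply: leq_trans (leq_bigmax x).
exact: (@leq_bigmax _ (fun y => distance x y) y).
Qed.

(* In each round, a minimal set covering the remaining nodes gives every
   parent a child that no other parent hears, so one slot takes a child away
   from every parent still in use. *)
Lemma slot_assignment (T : finType) (e : rel T) (n : nat) (X Y : {set T}) :
  (forall x, x \in X -> exists2 y, y \in Y & e x y) ->
  (forall y, y \in Y -> #|[set x in X | e x y]| <= n) ->
  exists (p : T -> T) (s : T -> nat), forall x, x \in X ->
    [/\ p x \in Y, e x (p x), s x < n &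
        forall x', x' \in X -> s x' = s x -> e x' (p x) -> x' = x].
Proof.
elim: n X Y => [|n IH] X Y HX HY.
  exists id, (fun=> 0) => x xX; have [y yY exy] := HX _ xX.
  have := HY _ yY; rewrite leqn0 => /eqP/cards0_eq/setP/(_ x).
  by rewrite !inE xX exy.
pose cov (M : {set T}) := (M \subset Y) && [forall x in X, exists y in M, e x y].
have covY : cov Y.
  rewrite /cov subxx; apply/forall_inP => x /HX[y yY exy].
  by apply/exists_inP; exists y.
have [M /minsetP[/andP[MY /forall_inP covM] minM] _] := minset_exists covY.
(* By minimality, dropping [y] from [M] uncovers some [x], and then [y] is the only element of [M]
   related to [x]. *)
have priv y : y \in M ->
    exists x, [&& x \in X, e x y & [forall y' in M, e x y' ==> (y' == y)]].
  move=> yM.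
  have : ~~ cov (M :\ y).
    apply/negP => c; have := minM _ c (subsetDl _ _).
    by move/setP/(_ y); rewrite !inE eqxx yM.
  rewrite /cov (subset_trans (subsetDl _ _) MY) /= => /forall_inPn[x xX].
  rewrite negb_exists_in => /forall_inP nx; exists x; rewrite xX /=.
  have u y' : y' \in M -> e x y' -> y' = y.
    move=> y'M exy'; apply/eqP/negPn/negP => ne.
    by have := nx y'; rewrite !inE ne y'M exy' => /(_ isT).
  have /exists_inP[z zM exz] := covM _ xX.
  rewrite -(u _ zM exz) exz /=; apply/forall_inP => y' y'M.
  by apply/implyP => exy'; rewrite (u _ zM exz) (u _ y'M exy').
pose q y := odflt y [pick x | [&& x \in X, e x y & [forall y' in M, e x y' ==> (y' == y)]]].
have qP y : y \in M -> [/\ q y \in X, e (q y) y & forall y', y' \in M -> e (q y) y' -> y' = y].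
  move=> yM; rewrite /q; case: pickP => [x /and3P[xX exy /forall_inP h]|h] /=.
    by split=> // y' y'M exy'; apply/eqP; apply: (implyP (h _ y'M)).
  by have [x] := priv y yM; rewrite h.
(* The private elements [q @: M] will take slot [n]. Every [y] in [M] thereby loses [q y], so the
   slots below [n] suffice for the rest. *)
have [||p [s ps]] := IH (X :\: q @: M) M.
- by move=> x /setDP[xX _]; apply/exists_inP/covM.
- move=> y yM; rewrite -ltnS; apply: leq_trans (HY y (subsetP MY y yM)).
  have [qX qe _] := qP y yM.
  apply: proper_card; apply/properP; split.
    by apply/subsetP => x; rewrite !inE => /andP[/andP[_ ->] ->].
  by exists (q y); rewrite !inE ?qX ?qe // imset_f.
exists (fun x => if [pick y in M | x == q y] is Some y then y else p x).
exists (fun x => if x \in q @: M then n else s x) => x xX.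
case: ifPn => xq; case: pickP => [y /andP[yM /eqP xy]|h].
- have [qX qe qu] := qP y yM; subst x.
  split=> //; first exact: (subsetP MY).
  move=> x' x'X; case: ifPn => [/imsetP[y' y'M ->] _ exy|x'q sn].
    by have [_ _ qu'] := qP y' y'M; rewrite (qu' _ yM exy).
  have [|_ _ ] := ps x'; first by rewrite inE x'q.
  by rewrite sn ltnn.
- by case/imsetP: xq => y yM xy; have := h y; rewrite yM xy eqxx.
- by rewrite xy imset_f in xq.
have [|pM ep sp su] := ps x; first by rewrite inE xq.
split=> //; [exact: (subsetP MY)|exact: ltnW|].
move=> x' x'X; case: ifPn => [_ sn|x'q]; first by rewrite -sn ltnn in sp.
by apply: su; rewrite inE x'q.
Qed.

(* First come first served, where serving an item serves every waiting item of
   the same slot; [r] gives the arrival times and [t] the service times. *)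
Lemma fifo (T : finType) (n : nat) (slot r : T -> nat) (S : {set T}) :
  (forall v, v \in S -> slot v < n) ->
  exists t : T -> nat,
  [/\ forall v, v \in S -> r v <= t v < r v + n,
      {in S &, forall u v, t u = t v -> slot u = slot v},
      {in S &, forall u v, slot u = slot v -> t u < t v -> t u < r v} &
      forall v i, v \in S -> r v <= i < t v -> exists2 u, u \in S & t u = i].
Proof.
move: {2}#|S| (leqnn #|S|) => m; elim: m S => [|m IH] S.
  rewrite leqn0 => /eqP/cards0_eq -> _; exists (fun=> 0).
  by split=> [v|u v|u v|v i]; rewrite inE.
move=> Sm slotn; have [->|[x0 x0S]] := set_0Vmem S.
  exists (fun=> 0).
  by split=> [v|u v|u v|v i]; rewrite inE.
(* An item [x] arriving last is inserted into the schedule [t0] of the others, which stays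
   unchanged. *)
have [x xS rmax] : exists2 x, x \in S & forall u, u \in S -> r u <= r x.
  by case: (arg_maxnP r x0S) => x; exists x.
have [||t0 [H1 H2 H3 H4]] := IH (S :\ x).
- by rewrite -ltnS (leq_trans _ Sm) // [leqRHS](cardsD1 x) xS.
- by move=> v /setD1P[_ /slotn].
suff [tx [K1 K2 K3 K4 K5]] : exists tx,
  [/\ r x <= tx,
      forall u, u \in S :\ x -> t0 u = tx -> slot u = slot x,
      forall u, u \in S :\ x -> slot u = slot x -> t0 u < tx -> t0 u < r x,
      forall u, u \in S :\ x -> slot u = slot x -> tx < t0 u -> tx < r u &
      forall i, r x <= i < tx -> exists2 u, u \in S :\ x & t0 u = i].
  pose t v := if v == x then tx else t0 v.
  have tE v : v \in S -> v = x /\ t v = tx \/ v \in S :\ x /\ t v = t0 v.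
    by rewrite /t !inE => ->; case: eqP => [->|_]; [left|right].
  have T2 : {in S &, forall u v, t u = t v -> slot u = slot v}.
    move=> u v /tE[] [uS ->] /tE[] [vS ->].
    - by rewrite uS vS.
    - by move=> e; rewrite uS (K2 v).
    - by move=> e; rewrite vS (K2 u).
    - exact: H2.
  have T3 : {in S &, forall u v, slot u = slot v -> t u < t v -> t u < r v}.
    move=> u v /tE[] [uS ->] /tE[] [vS ->].
    - by rewrite ltnn.
    - by rewrite uS => e; apply: K4.
    - by rewrite vS => e; apply: K3.
    - exact: H3.
  have S'S u : u \in S :\ x -> u \in S by case/setD1P.
  have tS' u : u \in S :\ x -> t u = t0 u.
    by rewrite /t; case/setD1P => /negbTE ->.
  have tx' : t x = tx by rewrite /t eqxx.
  have T4 v i : v \in S -> r v <= i < t v -> exists2 u, u \in S & t u = i.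
    move=> /tE[] [vS ->].
      by rewrite vS => /K5[u uS <-]; exists u; [exact: S'S|exact: tS'].
    by move=> /(H4 _ _ vS)[u uS <-]; exists u; [exact: S'S|exact: tS'].
  exists t; split=> // v /tE[] [vS tv]; last by rewrite tv H1.
  rewrite vS tx' K1 /=.
  (* [f j] is an item served at time [r x + j]. As all items have arrived by time [r x], two of
     these in one slot would violate first come, first served. So there are at most [n] of them. *)
  pose f (j : 'I_(tx - r x).+1) := odflt x [pick u in S | t u == r x + j].
  have fP j : f j \in S /\ t (f j) = r x + j.
    rewrite /f; case: pickP => [u /andP[uS /eqP] //|h]; exfalso.
    have [jlt|jge] := ltnP (r x + j) tx.
      have [|u uS tu] := T4 x (r x + j) xS; first by rewrite tx' leq_addr.
      by have := h u; rewrite uS tu eqxx.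
    have := h x; rewrite xS tx' /= => /eqP; apply.
    by have := ltn_ord j; lia.
  have finj : injective (fun j => Ordinal (slotn _ (fP j).1)).
    have lem j1 j2 : slot (f j1) = slot (f j2) -> ~~ (j1 < j2).
      move=> e; apply/negP => lt.
      have [[S1 e1] [S2 e2]] := (fP j1, fP j2).
      have := T3 _ _ S1 S2 e; rewrite e1 e2 ltn_add2l => /(_ lt).
      by have := rmax _ S2; lia.
    move=> j1 j2 /(congr1 val) /= e; apply: val_inj => /=.
    by have := lem _ _ e; have := lem _ _ (esym e); lia.
  have := leq_card _ finj; rewrite !card_ord; lia.
(* Either [x] shares the service of an item of its slot that is served no earlier than [r x], or it
   is served after all others. *)
have [/existsP[u /and3P[uS /eqP su ru]]|none] :=
  boolP [exists u, [&& u \in S :\ x, slot u == slot x & r x <= t0 u]].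
  have rux : r u <= r x by apply: rmax; case/setD1P: uS.
  exists (t0 u); split=> //.
  - by move=> w wS e; rewrite -su; apply: H2.
  - by move=> w wS e lt; apply: leq_trans rux; apply: (H3 w u) => //; rewrite e.
  - by move=> w wS e; apply: H3 => //; rewrite e.
  - by move=> i /andP[ri it]; apply: (H4 u) => //; rewrite it (leq_trans rux).
pose L := \max_(u in S :\ x) (t0 u).+1.
have LP u : u \in S :\ x -> t0 u < L.
  by move=> uS; apply: (@leq_bigmax_cond _ _ (fun u => (t0 u).+1) u uS).
have no u : u \in S :\ x -> slot u = slot x -> t0 u < r x.
  move=> uS su; rewrite ltnNge; apply: contra none => ru.
  by apply/existsP; exists u; rewrite uS su eqxx.
exists (maxn (r x) L); split.
- exact: leq_maxl.
- by move=> u uS; have := LP u uS; lia.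
- by move=> u uS su _; apply: no.
- by move=> u uS; have := LP u uS; lia.
- move=> i ilt.
  have [S0|[u0 u0S]] := set_0Vmem (S :\ x).
    by move: ilt; rewrite /L S0 big_set0; lia.
  (* [u] is served last and [r u <= r x], so the queue is busy from [r x] up to [t0 u]. *)
  have [|u uS Lu] := @eq_bigmax_cond _ (mem (S :\ x)) (fun u => (t0 u).+1).
    by apply/card_gt0P; exists u0.
  have rux : r u <= r x by apply: rmax; case/setD1P: uS.
  have [->|ne] := eqVneq i (t0 u); first by exists u.
  by apply: (H4 u) => //; move: ilt; rewrite /L Lu; lia.
Qed.

(** * The schedule *)

Section Schedule.
Variables (k : nat) (I : gathering k).
Local Notation layer := (distance (sink I)).

Lemma exists_gathering_tree :
  exists (parent : node I -> node I) (slot : node I -> nat), forall v, 0 < layer v ->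
    [/\ (layer (parent v)).+1 = layer v, adj v (parent v), slot v < max_degree I &
        forall u, layer u = layer v -> slot u = slot v -> adj u (parent v) -> u = v].
Proof.
have H l : exists ps : (node I -> node I) * (node I -> nat), forall v, layer v = l.+1 ->
    [/\ layer (ps.1 v) = l, adj v (ps.1 v), ps.2 v < max_degree I &
        forall u, layer u = l.+1 -> ps.2 u = ps.2 v -> adj u (ps.1 v) -> u = v].
  have [||p [s ps]] := @slot_assignment _ (@adj I) (max_degree I)
      [set v | layer v == l.+1] [set v | layer v == l].
  - move=> x; rewrite inE => /eqP lx.
    have [|z xz lz] := @distance_pred _ (sink I) x; first by rewrite lx.
    by exists z => //; rewrite inE -eqSS lz lx.
  - move=> y _; apply: leq_trans (leq_bigmax y).
    by apply/subset_leq_card/subsetP => x; rewrite !inE adj_sym => /andP[].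
  exists (p, s) => v lv; have [|] := ps v; first by rewrite inE lv.
  rewrite inE => /eqP lp ap sp up; split=> //= u lu; apply: up.
  by rewrite inE lu.
have [ps psP] := choice H.
exists (fun v => (ps (layer v).-1).1 v), (fun v => (ps (layer v).-1).2 v) => v lv.
have [|lp ap sp up] := psP (layer v).-1 v; first by rewrite prednK.
split=> //; first by rewrite lp prednK.
by move=> u lu; rewrite lu; apply: up; rewrite prednK.
Qed.

Variables (parent : node I -> node I) (slot : node I -> nat).
Hypothesis layer_parent : forall v, 0 < layer v -> (layer (parent v)).+1 = layer v.
Hypothesis slot_lt : forall v, 0 < layer v -> slot v < max_degree I.

(* The nodes other than the sink lying on the tree path from some source; the
   truncated subtraction is harmless, as it yields 0 only at the source. *)
Definition relevant v :=
  (0 < layer v) && [exists i, v == iter (layer (source I i) - layer v) parent (source I i)].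

Lemma relevant_layer v : relevant v -> 0 < layer v.
Proof. by case/andP. Qed.

(** Nothing is known about [parent] at the sink, so the layer is controlled only until the path
    reaches it. *)
Lemma layer_iter_parent v n : layer (iter n parent v) = layer v - n \/ layer v < n.
Proof.
elim: n => [|n IH]; first by left; rewrite subn0.
case: (ltnP (layer v) n.+1) => Hn; [by right|left].
have {}IH : layer (iter n parent v) = layer v - n by case: IH => //; lia.
by have := @layer_parent (iter n parent v); rewrite iterS IH; lia.
Qed.

Lemma relevant_source i : source I i = sink I \/ relevant (source I i).
Proof.
have [e|e] := eqVneq (sink I) (source I i); [by left|right].
rewrite /relevant lt0n distance_eq0 e /=; apply/existsP; exists i.
by rewrite subnn.
Qed.

Lemma relevant_layer_le v i :
  v = iter (layer (source I i) - layer v) parent (source I i) ->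
  layer v <= layer (source I i).
Proof.
move=> e; rewrite leqNgt; apply/negP => lt; move: e lt.
by have [/eqP -> -> /=|//] := boolP (layer (source I i) - layer v == 0); lia.
Qed.

Lemma relevant_parent v : relevant v -> parent v = sink I \/ relevant (parent v).
Proof.
move=> rv; have [lv /existsP[i /eqP e]] := andP rv.
have le := relevant_layer_le e; have lp := layer_parent lv.
have [p0|p0] := eqVneq (sink I) (parent v); [by left|right].
rewrite /relevant lt0n distance_eq0 p0 /=; apply/existsP; exists i.
have -> : layer (source I i) - layer (parent v) = (layer (source I i) - layer v).+1 by lia.
by rewrite iterS -e.
Qed.

(** The leaves of the relevant tree are sources; hence every other relevant node can be woken by a
    child. *)
Lemma relevant_child v : relevant v ->
  is_source v \/ exists2 c, relevant c & parent c = v.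
Proof.
move=> rv; have [lv /existsP[i /eqP e]] := andP rv.
have le := relevant_layer_le e.
case: (ltngtP (layer v) (layer (source I i))) => [lt|gt|eq]; last 2 first.
- by move: le; rewrite leqNgt gt.
- by left; apply/codomP; exists i; rewrite {1}e eq subnn.
right; set n := (layer (source I i) - layer v).-1.
have En : layer (source I i) - layer v = n.+1 by rewrite /n; lia.
exists (iter n parent (source I i)); last by rewrite -iterS -En.
have ln : layer (iter n parent (source I i)) = (layer v).+1.
  by case: (layer_iter_parent (source I i) n); lia.
apply/andP; rewrite ln; split=> //; apply/existsP; exists i; apply/eqP.
by congr iter; lia.
Qed.

(** A relevant node is determined by its layer and one source whose path visits it. Within [S] the
    value of [f] replaces the layer. *)
Lemma relevant_card (m : nat) (S : {set node I}) (f : node I -> 'I_m) :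
  {subset S <= relevant} -> {in S &, forall u v, f u = f v -> layer u = layer v} ->
  #|S| <= k * m.
Proof.
move=> Sr Sf; have [->|[x xS]] := set_0Vmem S; first by rewrite cards0.
have /andP[_ /existsP[i0 _]] := Sr _ xS.
pose g v := odflt i0 [pick i | v == iter (layer (source I i) - layer v) parent (source I i)].
have gP v : v \in S -> v = iter (layer (source I (g v)) - layer v) parent (source I (g v)).
  move=> /Sr/andP[_ /existsP[i e]]; rewrite /g; case: pickP => [j /eqP //|/(_ i)].
  by rewrite e.
have <- : #|{: 'I_k * 'I_m}| = k * m by rewrite card_prod !card_ord.
rewrite -(card_in_imset (f := fun v => (g v, f v))); first exact: max_card.
move=> u v uS vS [eg ef]; rewrite (gP u uS) (gP v vS) eg.
by rewrite (Sf u v uS vS ef).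
Qed.

(** The arrival time of [v] in the queue of its layer: all its relevant children have been served
    before. *)
Definition ready (t : node I -> nat) v :=
  \max_(c | relevant c && (parent c == v)) (t c).+1.

Definition served (t : node I -> nat) l :=
  [/\ forall v, relevant v -> layer v = l -> ready t v <= t v < ready t v + max_degree I,
      forall u v, relevant u -> relevant v -> layer u = l -> layer v = l ->
        t u = t v -> slot u = slot v &
      forall v i, relevant v -> layer v = l -> ready t v <= i < t v ->
        exists u, [/\ relevant u, layer u = l & t u = i]].

Lemma ready_ext (t t' : node I -> nat) v :
  (forall c, layer c = (layer v).+1 -> t c = t' c) -> ready t v = ready t' v.
Proof.
move=> e; apply: eq_bigr => c /andP[rc /eqP pc]; rewrite e // -pc.
by rewrite layer_parent // relevant_layer.
Qed.

(** The queues are filled from the farthest layer inwards: by [ready_ext] arrival times depend only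
    on the next layer out, so defining [t] on [l0] leaves the outer layers intact. *)
Lemma exists_service : exists t, forall l, served t l.
Proof.
pose D := diameter I.
have lD v : layer v <= D by apply: distance_le_diameter.
suff H j : exists t, forall l, D < l + j -> served t l.
  by have [t ht] := H D.+1; exists t => l; apply: ht; rewrite addnS ltnS leq_addl.
elim: j => [|j [t ht]].
  exists (fun=> 0) => l; rewrite addn0 => Dl.
  by split=> [v _ lv|u v _ _ lu|v i _ lv]; [have := lD v|have := lD u|have := lD v]; lia.
pose l0 := D - j.
have [|t' [t1 t2 _ t4]] := @fifo _ (max_degree I) slot (ready t)
    [set v | relevant v & layer v == l0].
  by move=> v; rewrite inE => /andP[/relevant_layer/slot_lt].
pose t'' v := if layer v == l0 then t' v else t v.
exists t'' => l Dl.
have tl v : layer v = l0 -> t'' v = t' v by move=> e; rewrite /t'' e eqxx.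
have tn v : layer v <> l0 -> t'' v = t v by move=> /eqP/negbTE e; rewrite /t'' e.
have rE v : l0 <= layer v -> ready t'' v = ready t v.
  by move=> lv; apply: ready_ext => c lc; apply: tn; lia.
have [El|Nl] := eqVneq l l0.
  subst l; split.
  - by move=> v rv lv; rewrite rE ?lv // tl //; apply: t1; rewrite inE rv lv eqxx.
  - move=> u v ru rv lu lv; rewrite !tl //.
    by apply: t2; rewrite inE ?ru ?rv ?lu ?lv eqxx.
  - move=> v i rv lv; rewrite rE ?lv // tl // => h.
    have [|u] := t4 v i _ h; first by rewrite inE rv lv eqxx.
    by rewrite inE => /andP[ru /eqP lu] tu; exists u; split=> //; rewrite tl.
have Dl' : D < l + j by lia.
have [s1 s2 s4] := ht l Dl'.
split.
- by move=> v rv lv; rewrite rE ?tn; [apply: s1|lia..].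
- by move=> u v ru rv lu lv; rewrite !tn; [apply: s2|lia..].
- move=> v i rv lv; rewrite rE ?tn; [|lia..] => h.
  by have [u [ru lu tu]] := s4 v i rv lv h; exists u; split=> //; rewrite tn //; lia.
Qed.

Variable t : node I -> nat.
Hypothesis served_t : forall l, served t l.

Lemma card_relevant_layer l : #|[set v | relevant v & layer v == l]| <= k.
Proof.
rewrite -[leqRHS]muln1; apply: (@relevant_card 1 _ (fun=> ord0)).
  by move=> v; rewrite inE => /andP[].
by move=> u v; rewrite !inE => /andP[_ /eqP ->] /andP[_ /eqP ->].
Qed.

Lemma ready_eq v : ready t v = 0 \/
  exists c, [/\ relevant c, parent c = v & ready t v = (t c).+1].
Proof.
have [/existsP[c cP]|no] := boolP [exists c, relevant c && (parent c == v)].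
  right; have [|c' /andP[rc /eqP pc] e] :=
    @eq_bigmax_cond _ [pred c | relevant c && (parent c == v)] (fun c => (t c).+1).
    by apply/card_gt0P; exists c.
  by exists c'; split.
left; rewrite /ready big_pred0 // => c; apply/negbTE; apply: contra no => h.
by apply/existsP; exists c.
Qed.

Lemma ready_child c : relevant c -> t c < ready t (parent c).
Proof.
by move=> rc; apply: (@leq_bigmax_cond _ _ (fun c => (t c).+1) c); rewrite rc eqxx.
Qed.

Lemma ready_le v : relevant v -> ready t v <= t v.
Proof. by move=> rv; have [/(_ v rv erefl)/andP[]] := served_t (layer v). Qed.

(** For the bound by [k]: every time from [ready t v] to [t v] serves a different relevant node of
    this layer, and there are at most [k] of these. *)
Lemma service_delay v : relevant v -> t v < ready t v + minn (max_degree I) k.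
Proof.
move=> rv; have [h1 _ h4] := served_t (layer v).
have /andP[le lt] := h1 v rv erefl.
rewrite addn_minr leq_min lt /=.
pose d := t v - ready t v.
pose f (j : 'I_d.+1) := odflt v [pick u | [&& relevant u, layer u == layer v & t u == ready t v + j]].
have fP j : [/\ relevant (f j), layer (f j) == layer v & t (f j) = ready t v + j].
  rewrite /f; case: pickP => [u /and3P[-> -> /eqP ->] //|h]; exfalso.
  have := ltn_ord j; rewrite ltnS leq_eqVlt => /orP[/eqP jd|jd].
    have := h v; by rewrite rv eqxx jd subnKC // eqxx.
  have [|u [ru lu tu]] := h4 v (ready t v + j) rv erefl; first by rewrite leq_addr -ltn_subRL.
  by have := h u; rewrite ru lu tu !eqxx.
have finj : injective f.
  move=> i j e; have [_ _ ti] := fP i; have [_ _ tj] := fP j.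
  by apply: val_inj => /=; rewrite e in ti; lia.
have : #|'I_d.+1| <= k.
  rewrite -(card_imset _ finj); apply: leq_trans (card_relevant_layer (layer v)).
  apply/subset_leq_card/subsetP => u /imsetP[j _ ->].
  by have [rf lf _] := fP j; rewrite inE rf lf.
by rewrite card_ord /d; lia.
Qed.

(* A busy service time of layer [l] removes one late node; after an idle one,
   every late node of layer [l] has a late child in layer [l.+1]. *)
Lemma card_late j l x : l + j = (diameter I).+1 ->
  #|[set v | [&& relevant v, layer v == l & j + x <= (t v).+1]]| <= k - x.
Proof.
elim: j l x => [|j IHj] l x lj.
  rewrite (_ : [set _ | _] = set0) ?cards0 //; apply/setP => v; rewrite !inE.
  apply/negP => /and3P[_ /eqP lv _].
  by have := @distance_le_diameter _ (sink I) v; lia.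
elim: x => [|x IHx].
  rewrite subn0; apply: leq_trans (card_relevant_layer l).
  by apply/subset_leq_card/subsetP => v; rewrite !inE => /and3P[-> ->].
have [/existsP[u /and3P[ru lu /eqP tu]]|no] :=
    boolP [exists u, [&& relevant u, layer u == l & t u == j + x]].
  rewrite subnS -ltnS (leq_trans _ (leqSpred _)) //; apply: leq_trans IHx.
  apply: proper_card; apply/properP; split.
    by apply/subsetP => v; rewrite !inE => /and3P[-> ->]; lia.
  by exists u; rewrite !inE ru lu tu ?leqnn //=; lia.
apply: leq_trans (IHj l.+1 x.+1 _); last by lia.
apply: leq_trans (leq_imset_card parent _).
apply/subset_leq_card/subsetP => v; rewrite inE => /and3P[rv /eqP lv tv].
have [_ _ h4] := served_t l.
have late : j + x < ready t v.
  rewrite ltnNge; apply/negP => le; case/negP: no.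
  have [|u [ru lu tu]] := h4 v (j + x) rv lv; first by lia.
  by apply/existsP; exists u; rewrite ru lu tu !eqxx.
have [r0|[c [rc pc re]]] := ready_eq v; first by lia.
apply/imsetP; exists c => //; rewrite inE rc /=.
have := layer_parent (relevant_layer rc); rewrite pc; lia.
Qed.

Lemma service_lt_add v : relevant v -> t v < diameter I - layer v + k.
Proof.
move=> rv; have le := @distance_le_diameter _ (sink I) v.
(* With [x := k] the bound on the number of late nodes becomes 0. *)
have := @card_late (diameter I - layer v).+1 (layer v) k.
rewrite subnn leqn0 addnS subnKC // => /(_ erefl)/eqP/cards0_eq/setP/(_ v).
by rewrite !inE rv eqxx /= addSn ltnS ltnNge => ->.
Qed.

Lemma service_lt_mul v : relevant v ->
  t v < ((diameter I).+1 - layer v) * max_degree I.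
Proof.
move: {-1}((diameter I).+1 - layer v) (erefl ((diameter I).+1 - layer v)) => j.
elim: j v => [|j IH] v lj rv.
  by have := @distance_le_diameter _ (sink I) v; lia.
have := service_delay rv; have [->|[c [rc pc ->]]] := ready_eq v; first by rewrite mulSn; lia.
have := layer_parent (relevant_layer rc); rewrite pc => lc.
by have := IH c _ rc; rewrite mulSn; lia.
Qed.

End Schedule.

(** * Executions and labels *)

Lemma receptionP k (I : gathering k) (sent : node I -> option (bitseq * seq 'I_k)) v m :
  reception sent v = Some m <->
  [/\ sent v = None & exists w, [/\ adj v w, sent w = Some m &
       forall u, adj v u -> isSome (sent u) -> u = w]].
Proof.
rewrite /reception; split.
  case sv: (sent v) => [//|]; case: pickP => // w /eqP sw sm; split=> //.
  have /setP swE := sw; have := swE w; rewrite !inE eqxx => /andP[vw _].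
  by exists w; split=> // u vu su; have := swE u; rewrite !inE vu su => /esym/eqP.
case=> -> [w [vw sw uw]].
have sE : [set u | adj v u & isSome (sent u)] = [set w].
  apply/setP => u; rewrite !inE; apply/andP/eqP => [[]|->]; first exact: uw.
  by rewrite sw.
case: pickP => [w'|/(_ w)]; last by rewrite sE eqxx.
by rewrite sE => /eqP/setP/(_ w); rewrite !inE eqxx => /esym/eqP <-.
Qed.

Lemma size_held_initial k (I : gathering k) (v : node I) :
  size (held (initial v)) = is_source v.
Proof.
rewrite /= size_filter /is_source; case: codomP => [[i ->]|no].
  rewrite (eq_count (a2 := pred1 i)) => [|j]; last by rewrite /= (inj_eq (@source_inj _ I)).
  by rewrite count_uniq_mem ?enum_uniq // mem_enum.
rewrite (eq_count (a2 := pred0)) ?count_pred0 // => j; apply/negbTE/eqP => e.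
by apply: no; exists j.
Qed.

Definition binary (s : bitseq) : nat := foldr (fun (b : bool) n => b + n.*2) 0 s.

Lemma binary_surj b n : n < 2 ^ b -> exists2 s, size s = b & binary s = n.
Proof.
elim: b n => [|b IH] n.
  by rewrite expn0 ltnS leqn0 => /eqP ->; exists [::].
rewrite expnS => lt; have [|s ss sn] := IH n./2; first by lia.
by exists (odd n :: s); rewrite /= ?ss // sn odd_double_half.
Qed.

(** The empty label marks nodes that never transmit; the leading bit, of arbitrary value, marks the
    others. Halves of equal length need no separator. *)
Definition decode (s : bitseq) : option (nat * nat) :=
  if s is _ :: s' then
    Some (binary (take (size s')./2 s'), binary (drop (size s')./2 s'))
  else None.

Lemma decode_surj b m d : m < 2 ^ b -> d < 2 ^ b ->
  exists2 s, size s = b.*2.+1 & decode s = Some (m, d).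
Proof.
move=> /binary_surj[s1 <- <-] /binary_surj[s2 ss <-].
exists (true :: s1 ++ s2); first by rewrite /= size_cat ss addnn.
rewrite /= size_cat ss addnn doubleK take_size_cat //.
by rewrite drop_size_cat.
Qed.

(* The only transmission comes [d] silent rounds after the [m]-th reception.
   The positions sent cover all messages held; those beyond the end of the
   list are ignored. *)
Definition relay_once : algorithm := fun label _ h =>
  if decode label is Some (m, d) then
    if (count isSome h == m) && (find isSome (rev h) == d)
    then Transmit [::] (iota 0 (sumn [seq oapp snd 0 o | o <- h]).+1)
    else Listen
  else Listen.

(** While the number of receptions stays the same, the trailing silence grows, so the two numbers in
    a label single out one round. *)
Lemma count_find_rev_inj (f : nat -> bool) m n :
  count id (map f (iota 0 m)) = count id (map f (iota 0 n)) ->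
  find id (rev (map f (iota 0 m))) = find id (rev (map f (iota 0 n))) -> m = n.
Proof.
wlog le : m n / m <= n => [H c d|].
  by case: (leqP m n) => [/H|/ltnW/H H']; [apply|symmetry; apply: H'].
have -> : n = m + (n - m) by lia.
move: (n - m) => j; rewrite iotaD map_cat count_cat add0n rev_cat find_cat.
move=> /eqP; rewrite -[X in X == _]addn0 eqn_add2l eq_sym.
rewrite -leqn0 leqNgt -has_count -has_rev => /negbTE ->.
by rewrite size_rev size_map size_iota; lia.
Qed.

(** * Executions that follow a transmission schedule *)

Section Run.
Variables (k : nat) (I : gathering k).
Variables (rel : pred (node I)) (parent : node I -> node I) (T : node I -> nat).

(** The predicted receptions, if each node [u] of [rel] transmits exactly in round [T u] and no
    other node ever does. *)
Definition hears v i := ~~ (rel v && (T v == i)) &&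
  (#|[set u | [&& adj v u, rel u & T u == i]]| == 1).

Definition heard v n := [seq hears v i | i <- iota 0 n].

Hypothesis rel_child : forall v, rel v -> is_source v \/ exists2 c, rel c & parent c = v.
Hypothesis rel_parent : forall v, rel v -> parent v = sink I \/ rel (parent v).
Hypothesis parent_adj : forall v, rel v -> adj (parent v) v.
Hypothesis parent_hears : forall v, rel v -> hears (parent v) (T v).
Hypothesis parent_later : forall v, rel v -> rel (parent v) -> T v < T (parent v).
Hypothesis rel_source : forall i, source I i = sink I \/ rel (source I i).

Variable lab : node I -> bitseq.
Hypothesis decode_lab : forall v, decode (lab v) =
  if rel v then Some (count id (heard v (T v)), find id (rev (heard v (T v))))
  else None.

Local Notation state_at := (run relay_once lab).
Local Notation sent_at n := (fun w => transmission relay_once lab w (state_at n w)).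

Lemma heardS v n : heard v n.+1 = rcons (heard v n) (hears v n).
Proof. by rewrite /heard -addn1 iotaD map_cat cats1. Qed.

Lemma transmission_relay v n :
  map isSome (history (state_at n v)) = heard v n ->
  isSome (sent_at n v) = rel v && (T v == n).
Proof.
move=> hn; rewrite /transmission /relay_once decode_lab.
case rv: (rel v) => /=; last by case: ifP.
have cE : count isSome (history (state_at n v)) = count id (heard v n).
  by rewrite -hn count_map.
have fE : find isSome (rev (history (state_at n v))) = find id (rev (heard v n)).
  by rewrite -hn -map_rev find_map.
rewrite cE fE; have [e|ne] := eqVneq (T v) n; last first.
  rewrite (_ : _ && _ = false) //=; first by case: ifP.
  apply: contra_neqF ne => /andP[/eqP c /eqP f].
  by symmetry; apply: (count_find_rev_inj c f).
subst n; rewrite !eqxx /= /awake ifT //.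
(* A node that is not a source was woken at the latest by its child [c], heard in the earlier round
   [T c]. *)
have [->//|[c rc pc]] := rel_child rv; apply/orP; right.
rewrite -(has_map isSome id) hn has_map; apply/hasP; exists (T c) => /=.
  by rewrite mem_iota /= add0n -pc parent_later ?pc.
by rewrite -pc parent_hears.
Qed.

(** Correct predictions for the past make all nodes follow [T] in the current round, which makes the
    next prediction correct. *)
Lemma run_heard n v : map isSome (history (state_at n v)) = heard v n.
Proof.
elim: n v => [//|n IH] v.
rewrite /= map_rcons IH heardS; congr rcons.
have tr u := transmission_relay (IH u).
rewrite (_ : isSome (omap _ _) = isSome (reception (sent_at n) v)); last by case: reception.
apply/idP/idP.
  case re: reception => [m|//] _; have [sv [w [vw sw uw]]] := (receptionP _ _ _).1 re.
  rewrite /hears -tr sv /=; apply/cards1P; exists w; apply/setP => u; rewrite !inE -tr.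
  apply/andP/eqP => [[]|->]; first exact: uw.
  by rewrite vw sw.
case/andP; rewrite -tr => sv /cards1P[w /setP wP].
have := wP w; rewrite !inE eqxx -tr => /andP[vw]; case sw: (sent_at n w) => [m|//] _.
rewrite ((receptionP _ _ m).2 _) //; split; first by case: (sent_at n v) sv.
exists w; split=> // u vu; rewrite (tr u) => su.
by have := wP u; rewrite !inE vu su => /esym/eqP.
Qed.

Lemma run_transmission v n : isSome (sent_at n v) = rel v && (T v == n).
Proof. by apply: transmission_relay; apply: run_heard. Qed.

(** So the positions sent by [relay_once] cover the whole list; the extra one accounts for the
    node's own message. *)
Lemma size_held n v :
  size (held (state_at n v)) <= (sumn [seq oapp snd 0 o | o <- history (state_at n v)]).+1.
Proof.
elim: n => [|n IH]; first by rewrite size_held_initial; case: is_source.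
rewrite /= size_cat map_rcons sumn_rcons -addSn leq_add //.
by case: reception.
Qed.

Lemma held_mono i n n' v : n <= n' -> i \in held (state_at n v) -> i \in held (state_at n' v).
Proof.
move=> /subnKC <-; elim: (n' - n) => [|j IH]; first by rewrite addn0.
by rewrite addnS /= mem_cat => /IH ->.
Qed.

Lemma held_parent i v : rel v -> i \in held (state_at (T v) v) ->
  i \in held (state_at (T v).+1 (parent v)).
Proof.
move=> rv iv; rewrite /= mem_cat; apply/orP; right.
have := run_transmission v (T v); rewrite rv eqxx /=.
case sv: (transmission _ _ _ _) => [m|//] _.
have /andP[np /cards1P[w /setP wP]] := parent_hears rv.
have vw : v = w.
  by apply/eqP; have := wP v; rewrite !inE parent_adj // rv eqxx.
rewrite ((receptionP _ _ m).2 _); last first.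
  split; first by move: np; rewrite -run_transmission; case: transmission.
  exists v; split=> [||u pu su]; [exact: parent_adj|exact: sv|].
  by apply/eqP; have := wP u; rewrite !inE pu -run_transmission su vw.
rewrite /oapp; move: sv; rewrite /transmission; case: ifP => // _.
case E: (relay_once _ _ _) => [//|c js] [<-]; move: E; rewrite {1}/relay_once.
case: decode => [[a b]|//]; case: ifP => // _ [_ <-].
rewrite mem_pmap; apply/mapP.
exists (index i (held (state_at (T v) v))); last first.
  by rewrite onthE (nth_map i) ?index_mem // nth_index.
by rewrite -[0 :: _]/(iota 0 _.+1) mem_iota /= add0n (leq_trans _ (size_held _ _)) // index_mem.
Qed.

Lemma relay_once_gathers n : (forall v, rel v -> T v < n) -> gathers_in relay_once lab n.
Proof.
move=> Tn i.
(* Along parents [T] increases and stays below [n], so [n - T v] decreases. *)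
have sinkP v m : rel v -> n - T v <= m -> i \in held (state_at (T v) v) ->
    i \in held (state_at n (sink I)).
  elim: m v => [|m IH] v rv; have lt := Tn v rv; first by lia.
  move=> le /(held_parent rv) ip.
  have [<-|rp] := rel_parent rv; first exact: held_mono ip.
  have pl := parent_later rv rp; apply: (IH _ rp); first by lia.
  exact: held_mono ip.
have own : i \in held (state_at 0 (source I i)) by rewrite /= mem_filter eqxx mem_enum.
have [<-|rs] := rel_source i; first exact: held_mono own.
by apply: (sinkP _ _ rs (leqnn _)); apply: held_mono own.
Qed.

End Run.

(** Different reception rounds belong to different relevant neighbors, since each has a single round
    [T u]. *)
Lemma count_heard_le k (I : gathering k) (rel : pred (node I)) T v n :
  count id (heard rel T v n) <= #|[set u | adj v u & rel u]|.
Proof.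
rewrite count_map -size_filter cardE -(size_map T).
apply: uniq_leq_size; first by rewrite filter_uniq ?iota_uniq.
move=> i; rewrite mem_filter => /andP[/andP[_ /cards1P[u /setP/(_ u) +]] _].
rewrite !inE eqxx => /and3P[vu ru /eqP <-].
by apply/mapP; exists u => //; rewrite mem_enum inE vu.
Qed.

Lemma find_heard_le k (I : gathering k) (rel : pred (node I)) T v i n :
  i < n -> hears rel T v i -> find id (rev (heard rel T v n)) <= n - i.+1.
Proof.
move=> lt hi; rewrite leqNgt; apply/negP => /(before_find false).
have sz : size (heard rel T v n) = n by rewrite size_map size_iota.
have b : i < size (iota 0 n) by rewrite size_iota.
rewrite nth_rev sz ?subnKC; last by lia.
rewrite (_ : n - _ = i) ?(nth_map 0) ?nth_iota ?hi //; by lia.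
Qed.

Lemma find_heard_le_size k (I : gathering k) (rel : pred (node I)) T v n :
  find id (rev (heard rel T v n)) <= n.
Proof. by rewrite -[leqRHS](size_iota 0) -(size_map (hears rel T v)) -size_rev find_size. Qed.

Lemma exists_relay_labels k (I : gathering k) : 0 < k -> 0 < max_degree I ->
  exists lab : node I -> bitseq,
    label_length lab <= 7 + (trunc_log 2 (minn (max_degree I) k)).*2 /\
    gathers_in relay_once lab (3 * minn (diameter I + k) (diameter I * max_degree I)).
Proof.
move=> k0 D0; pose layer := distance (sink I).
have [parent [slot tree]] := exists_gathering_tree I.
have lp v : 0 < layer v -> (layer (parent v)).+1 = layer v by case/tree.
have sl v : 0 < layer v -> slot v < max_degree I by case/tree.
have [t st] := exists_service lp sl.
pose rel := relevant parent.
have rl v : rel v -> 0 < layer v by apply: relevant_layer.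
(* Neighbors of a node lie in three consecutive layers, so those transmitting in
   the same round belong to the same layer. *)
pose T v := 3 * t v + layer v %% 3.
have later v : rel v -> rel (parent v) -> T v < T (parent v).
  move=> rv rp; have := ready_child t rv; have := ready_le st rp.
  by rewrite /T; lia.
have hp v : rel v -> hears rel T (parent v) (T v).
  move=> rv; apply/andP; split.
    by apply/negP => /andP[rp /eqP e]; have := later v rv rp; rewrite e ltnn.
  have [lpv av _ uv] := tree v (rl v rv).
  apply/cards1P; exists v; apply/setP => u; rewrite !inE.
  apply/and3P/eqP => [[pu ru /eqP Tu]|->]; last by rewrite adj_sym av rv eqxx.
  have tu : t u = t v by rewrite /T in Tu; lia.
  have lu : layer u = layer v.
    have up : adj u (parent v) by rewrite adj_sym.
    have := distance_adj (sink I) pu; have := distance_adj (sink I) up.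
    have := rl u ru; rewrite /T in Tu; rewrite /layer in Tu *; lia.
  apply: uv => //; last by rewrite adj_sym.
  by have [_ + _] := st (layer v); apply.
(* [M] is less than 2 to the power [(trunc_log 2 M).+1], so two further bits make room for
   [3 * M + 1]. *)
pose M := minn (max_degree I) k; pose b := (trunc_log 2 M).+3.
have bP n : n <= 3 * M + 1 -> n < 2 ^ b.
  have M0 : 0 < M by rewrite /M leq_min D0.
  have := @trunc_log_ltn 2 M isT; rewrite /b !expnS; lia.
(* The neighbors of [v] lie in three consecutive layers, each with at most [k] relevant nodes. *)
have mP v : count id (heard rel T v (T v)) <= 3 * M + 1.
  apply: leq_trans (count_heard_le _ _ _ _) _.
  suff : #|[set u | adj v u & rel u]| <= minn (max_degree I) (k * 3) by rewrite /M; lia.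
  rewrite leq_min; apply/andP; split.
    apply: leq_trans (leq_bigmax v).
    by apply/subset_leq_card/subsetP => u; rewrite !inE => /andP[].
  apply: (@relevant_card _ _ parent 3 _ (fun u => Ordinal (@ltn_pmod (layer u) 3 isT))).
    by move=> u; rewrite inE => /andP[].
  move=> u w; rewrite !inE => /andP[vu _] /andP[vw _] /(congr1 val) /=.
  have := distance_adj (sink I) vu; have := distance_adj (sink I) vw.
  rewrite adj_sym in vu; rewrite adj_sym in vw.
  have := distance_adj (sink I) vu; have := distance_adj (sink I) vw.
  rewrite /layer; lia.
(* If [c] is the child served last, then [t v <= t c + M] and the residues modulo 3 differ by at
   most 2. Hence at most [3 * M + 1] rounds lie strictly between [T c] and [T v]. *)
have dP v : rel v -> find id (rev (heard rel T v (T v))) <= 3 * M + 1.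
  move=> rv; have del := service_delay st rv.
  have [r0|[c [rc pc rE]]] := ready_eq parent t v.
    apply: leq_trans (find_heard_le_size _ _ _ _) _.
    by rewrite r0 -/M in del; rewrite /T; lia.
  have := hp c rc; have := later c rc; rewrite pc => /(_ rv) lt /(find_heard_le lt).
  by rewrite rE -/M in del; rewrite /T; lia.
have /choice[lab labP] v : exists s, size s <= b.*2.+1 /\ decode s =
    if rel v then Some (count id (heard rel T v (T v)), find id (rev (heard rel T v (T v))))
    else None.
  case rv: (rel v); last by exists [::].
  have [s ss sd] := decode_surj (bP _ (mP v)) (bP _ (dP v rv)).
  by exists s; rewrite ss.
exists lab; split.
  by apply/bigmax_leqP => v _; have [le _] := labP v; apply: leq_trans le _; rewrite /b doubleS !doubleS.
apply: (@relay_once_gathers _ _ rel parent T).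
- exact: relevant_child.
- exact: relevant_parent.
- by move=> v /rl/tree[_ av _ _]; rewrite adj_sym.
- exact: hp.
- exact: later.
- exact: relevant_source.
- by move=> v; have [] := labP v.
move=> v rv; have l0 := rl v rv.
have := service_lt_add lp st rv; have := service_lt_mul lp st rv.
have : ((diameter I).+1 - layer v) * max_degree I <= diameter I * max_degree I.
  by rewrite leq_mul2r; lia.
by rewrite /T -/layer; lia.
Qed.

(** * Symmetric executions *)

(** A block of zeros closed by a one, put in front, turns strings of length at most [L] injectively
    into strings of length [L.+1]. *)
Lemma injective_bitseq_card m L (f : 'I_m -> bitseq) :
  injective f -> (forall i, size (f i) <= L) -> m <= 2 ^ L.+1.
Proof.
move=> finj fL; pose pad s := nseq (L - size s) false ++ true :: s.
have padK s : drop (find id (pad s)).+1 (pad s) = s.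
  rewrite /pad find_cat has_nseq andbF size_nseq /= addn0.
  by rewrite -cat_rcons drop_size_cat // size_rcons size_nseq.
have padS i : size (pad (f i)) == L.+1.
  by rewrite size_cat size_nseq /= addnS subnK.
have : injective (fun i => Tuple (padS i)).
  by move=> i j /(congr1 val) /= e; apply: finj; rewrite -(padK (f i)) e padK.
by move=> /leq_card; rewrite card_ord card_tuple card_bool.
Qed.

Section Symmetry.
Variables (k : nat) (I : gathering k) (A : algorithm) (lab : node I -> bitseq).
Variable phi : node I -> node I.
Hypothesis phiK : involutive phi.
Hypothesis phi_adj : forall u v, adj (phi u) (phi v) = adj u v.
Hypothesis phi_source : forall v, is_source (phi v) = is_source v.
Hypothesis phi_lab : forall v, lab (phi v) = lab v.

Local Notation shape := (omap (fun m : bitseq * seq 'I_k => (m.1, size m.2))).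
Local Notation sent_at n := (fun w => transmission A lab w (run A lab n w)).

Lemma reception_symmetric (sent : node I -> option (bitseq * seq 'I_k)) v :
  (forall u, shape (sent (phi u)) = shape (sent u)) ->
  shape (reception sent (phi v)) = shape (reception sent v).
Proof.
move=> sE.
have H u m : reception sent u = Some m -> shape (reception sent (phi u)) = shape (Some m).
  move=> /receptionP[su [w [uw sw wu]]].
  have := sE u; have := sE w; rewrite su sw.
  case sw': (sent (phi w)) => [m'|//] mE; case su': (sent (phi u)) => [//|] _.
  rewrite -mE; congr (shape _); apply/receptionP; split=> //.
  exists (phi w); split=> // [|x]; first by rewrite phi_adj.
  rewrite -{1}(phiK x) phi_adj => ux sx; rewrite -[x]phiK; congr phi; apply: wu => //.
  by have := sE x; case: (sent x) sx => // ? _; case: (sent (phi x)).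
case re: (reception sent v) => [m|]; first exact: H.
case re': (reception sent (phi v)) => [m|//].
by have := H _ _ re'; rewrite phiK re.
Qed.

(** Observations hide which messages arrive, so nodes exchanged by [phi] act alike. The size of
    [held] is included because it decides how many requested positions yield a message. *)
Lemma run_symmetric n v :
  history (run A lab n (phi v)) = history (run A lab n v) /\
  size (held (run A lab n (phi v))) = size (held (run A lab n v)).
Proof.
elim: n v => [|n IH] v; first by rewrite !size_held_initial phi_source.
have sE u : shape (sent_at n (phi u)) = shape (sent_at n u).
  have [hu su] := IH u; rewrite /transmission /awake phi_source phi_lab hu.
  case: ifP => // _; case: (A _ _ _) => //= c js; congr (Some (_, _)).
  rewrite !size_pmap; apply: eq_count => j /=.
  by rewrite !onthTE su.
have [hv sv] := IH v; rewrite /= hv !size_cat sv.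
have := reception_symmetric v sE.
by case: (reception _ (phi v)) => [m|]; case: (reception _ v) => [m'|] //= [-> ->].
Qed.

Variable W : pred (node I).
Hypothesis sink_notin : ~~ W (sink I).
Hypothesis phi_sink : phi (sink I) = sink I.
Hypothesis W_closed : forall w v, W w -> adj v w -> W v \/ v = sink I.
Hypothesis W_moved : forall w, W w -> adj (sink I) w -> phi w <> w.

(** A message can leave [W] only into the sink. But whenever a neighbor [w] of the sink in [W]
    transmits, so does the other neighbor [phi w], and they collide. *)
Lemma held_confined i : W (source I i) ->
  forall n v, i \in held (run A lab n v) -> W v.
Proof.
move=> Wi n; elim: n => [|n IH] v /=.
  by rewrite mem_filter => /andP[/eqP <-].
rewrite mem_cat => /orP[/IH //|].
case re: reception => [m|//]; have [sv [w [vw sw uw]]] := (receptionP _ _ _).1 re.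
move=> /= im; have Ww : W w.
  apply: IH; move: sw; rewrite /transmission; case: ifP => // _.
  case: (A _ _ _) => // c js [mE]; move: im; rewrite -mE /= mem_pmap.
  by case/mapP => j _ /esym e; apply/onthP; exists j.
case: (W_closed Ww vw) => // v_sink; exfalso; subst v.
apply: (W_moved Ww vw); apply: uw; first by rewrite -phi_sink phi_adj.
have [hw sE] := run_symmetric n w; move: sw.
rewrite /transmission /awake phi_source phi_lab hw; case: ifP => // _.
by case: (A _ _ _).
Qed.

Lemma not_gathers_in i n : W (source I i) -> ~ gathers_in A lab n.
Proof. by move=> Wi /(_ i)/(held_confined Wi); apply/negP. Qed.

End Symmetry.

(** * A cycle through the sink with pendant nodes *)

(* The sink [None] lies on the cycle [None, 0, ..., p.-1] and carries the
   pendant nodes [p, ..., n.-1]. *)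
Definition lasso n p (x y : option 'I_n) : bool :=
  match x, y with
  | Some i, Some j => [&& i < p, j < p & (i.+1 == j) || (j.+1 == i)]
  | None, Some i | Some i, None => (val i == 0) || (p.-1 <= i)
  | None, None => false
  end.

Section Lasso.
Variables n p : nat.

Lemma lasso_sym : symmetric (@lasso n p).
Proof. by case=> [i|] [j|] //=; lia. Qed.

Lemma lasso_irr : irreflexive (@lasso n p).
Proof. by case=> [i|] //=; lia. Qed.

Lemma lasso_connected x y : connect (@lasso n p) x y.
Proof.
suff H z : connect (@lasso n p) None z.
  by apply: connect_trans (H y); rewrite (sym_connect_sym lasso_sym).
case: z => [[i lt]|]; last exact: connect0.
elim: i lt => [|i IH] lt; first exact: connect1.
have [lp|ge] := ltnP i.+1 p; last by apply: connect1 => /=; lia.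
by apply: connect_trans (IH (ltnW lt)) (connect1 _) => /=; lia.
Qed.

Definition lasso_network := Network lasso_sym lasso_irr lasso_connected.

Hypotheses (p2 : 2 <= p) (pn : p <= n).

Lemma lasso_max_degree : max_degree lasso_network = n - p + 2.
Proof.
have dN : degree (None : node lasso_network) = n - p + 2.
  (* The sink's neighbors are 0, the image of index 0, and [p.-1, ..., n.-1], the images of the
     positive indices. *)
  have fP (j : 'I_(n - p + 2)) : (if val j == 0 then 0 else p - 2 + j) < n.
    by have := ltn_ord j; case: eqP; lia.
  pose f j : option 'I_n := Some (Ordinal (fP j)).
  have finj : injective f.
    by move=> i j [] e; apply: val_inj => /=; move: e; case: eqP; case: eqP; lia.
  rewrite -[RHS]card_ord -(card_imset _ finj); apply: eq_card => x.
  rewrite inE; apply/idP/imsetP => [|[j _ ->]]; last first.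
    by rewrite /=; case: (eqVneq (nat_of_ord j) 0) => /= j0; lia.
  case: x => [i|//] ai; have lt : (if val i == 0 then 0 else i - (p - 2)) < n - p + 2.
    by have := ltn_ord i; case: eqP; lia.
  exists (Ordinal lt) => //; congr Some; apply: val_inj => /=.
  by move: ai => /=; case: eqP => [->//|] ? ?; case: eqP; lia.
apply/eqP; rewrite eqn_leq; apply/andP; split; last by rewrite -dN (leq_bigmax None).
apply/bigmax_leqP => -[i|] _; last by rewrite dN.
apply: leq_trans (leq_addl _ 2).
(* The two candidates are the predecessor and the successor on the cycle, with the sink [None]
   closing it at both ends. *)
apply: (@leq_trans #|[set (if val i == 0 then None else insub i.-1 : option 'I_n);
                        (if p.-1 <= i then None else insub i.+1)]|); last first.
  by rewrite cards2; case: eqP.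
apply/subset_leq_card/subsetP => -[j|]; rewrite !inE /=; last first.
  by case/orP => ->; rewrite ?orbT.
move=> /and3P[ip jp /orP[/eqP e|/eqP e]]; apply/orP; [right|left].
  by rewrite leqNgt (_ : i < p.-1) /=; [rewrite e valK|lia].
by rewrite -e /= valK.
Qed.

(** The reflection of the cycle through the sink, fixing all pendant nodes. *)
Definition lasso_rev (x : option 'I_n) : option 'I_n :=
  if x is Some i then if i < p then insub (p.-1 - i) else Some i else None.

Lemma lasso_revE i (lt : i < n) : i < p ->
  exists lt', lasso_rev (Some (Ordinal lt)) = Some (@Ordinal n (p.-1 - i) lt').
Proof.
by move=> ip; have lt' : p.-1 - i < n by [lia]; exists lt'; rewrite /= ip insubT.
Qed.

Lemma lasso_revE' (i : 'I_n) : p <= i -> lasso_rev (Some i) = Some i.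
Proof. by rewrite leqNgt /= => /negbTE ->. Qed.

Lemma lasso_revK : involutive lasso_rev.
Proof.
case=> [[i lt]|//]; have [ip|ip] := ltnP i p; last by rewrite !lasso_revE'.
have [lt' ->] := lasso_revE lt ip; have [|lt'' ->] := lasso_revE lt'; first by lia.
by congr Some; apply: val_inj => /=; lia.
Qed.

Lemma lasso_rev_adj x y : lasso p (lasso_rev x) (lasso_rev y) = lasso p x y.
Proof.
case: x => [[i lti]|]; case: y => [[j ltj]|] //.
- have [ip|ip] := ltnP i p; have [jp|jp] := ltnP j p.
  + by have [? ->] := lasso_revE lti ip; have [? ->] := lasso_revE ltj jp => /=; lia.
  + by have [? ->] := lasso_revE lti ip; rewrite lasso_revE' //=; lia.
  + by have [? ->] := lasso_revE ltj jp; rewrite lasso_revE' //=; lia.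
  + by rewrite !lasso_revE'.
- have [ip|ip] := ltnP i p; last by rewrite lasso_revE'.
  by have [? ->] := lasso_revE lti ip => /=; lia.
- have [jp|jp] := ltnP j p; last by rewrite lasso_revE'.
  by have [? ->] := lasso_revE ltj jp => /=; lia.
Qed.

Variables (k : nat) (kn : k <= n).

Definition lasso_source (i : 'I_k) : node lasso_network := Some (widen_ord kn i).

Lemma lasso_source_inj : injective lasso_source.
Proof. by move=> i j [] e; apply: val_inj. Qed.

Definition lasso_gathering := Gathering lasso_source_inj (None : node lasso_network).

Lemma lasso_is_source (x : node lasso_gathering) :
  is_source x = if x is Some i then val i < k else false.
Proof.
apply/codomP/idP => [[i ->]|]; first exact: (ltn_ord i).
by case: x => [i|//] ik; exists (Ordinal ik); congr Some; apply: val_inj.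
Qed.

(** If all labels are empty, [lasso_rev] is a symmetry: by [p <= k] all cycle nodes but possibly the
    sink are sources. It swaps the distinct cycle neighbors 0 and [p.-1] of the sink. *)
Lemma lasso_label_neq0 (A : algorithm) t (lab : node lasso_gathering -> bitseq) :
  p <= k -> gathers_in A lab t -> 0 < label_length lab.
Proof.
move=> pk g; have k0 : 0 < k by [lia]; rewrite lt0n; apply/negP => /eqP l0.
have labE v : lab v = [::].
  by apply/nilP; rewrite /nilp -leqn0 -l0 (leq_bigmax v).
pose W (x : node lasso_gathering) := if x is Some i then val i < p else false.
apply: (@not_gathers_in k lasso_gathering A lab lasso_rev lasso_revK lasso_rev_adj
  _ _ W _ _ _ _ (Ordinal k0) t _ g) => //.
- move=> x; rewrite !lasso_is_source; case: x => [[i lt]|//].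
  have [ip|ip] := ltnP i p; last by rewrite lasso_revE'.
  by have [? ->] := lasso_revE lt ip => /=; lia.
- by move=> v; rewrite !labE.
- by case=> [i|//] [j|] /=; [lia|right].
- case=> [[i lt]|//] /= ip; have [lt' e] := lasso_revE lt ip.
  move=> ai; rewrite /= in e *; rewrite e => -[]; lia.
- by rewrite /=; lia.
Qed.

(** Transposing two pendant sources with equal labels would be a symmetry, confining their messages;
    so these labels are distinct. *)
Lemma lasso_leaf_labels (A : algorithm) t (lab : node lasso_gathering -> bitseq) :
  gathers_in A lab t -> k - p <= 2 ^ (label_length lab).+1.
Proof.
move=> g; have lt (i : 'I_(k - p)) : p + i < n by have := ltn_ord i; lia.
pose leaf i : node lasso_gathering := Some (Ordinal (lt i)).
apply: (@injective_bitseq_card _ _ (lab \o leaf)) => [i j /= e|i]; last exact: leq_bigmax.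
apply/eqP/negPn/negP => ne.
have ltk : p + i < k by have := ltn_ord i; lia.
have leafN (a : 'I_(k - p)) (x : node lasso_gathering) : adj (leaf a) x = (x == None).
  by case: x => [x|]; rewrite -[LHS]/(lasso p _ _) /= ?eqxx; [rewrite -[RHS]/false|]; lia.
have leafN' (a : 'I_(k - p)) (x : node lasso_gathering) : adj x (leaf a) = (x == None).
  by rewrite adj_sym leafN.
apply: (@not_gathers_in k lasso_gathering A lab (tperm (leaf i) (leaf j)) (tpermK _ _)
  _ _ _ [pred x | (x == leaf i) || (x == leaf j)] _ _ _ _ (Ordinal ltk) t _ g) => //.
- move=> u v; case: (tpermP _ _ u) => [->|->|/eqP ui /eqP uj];
    case: (tpermP _ _ v) => [->|->|/eqP vi /eqP vj]; by rewrite ?leafN ?leafN'.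
- move=> v; case: (tpermP _ _ v) => [->|->|//]; rewrite !lasso_is_source /=.
    by have := ltn_ord i; have := ltn_ord j; lia.
  by have := ltn_ord i; have := ltn_ord j; lia.
- by move=> v; case: (tpermP _ _ v) => [->|->|//].
- by rewrite tpermD.
- by move=> w v /orP[/eqP ->|/eqP ->]; rewrite leafN' => /eqP ->; right.
- move=> w /orP[/eqP ->|/eqP ->] _; rewrite ?tpermL ?tpermR => -[].
    by move=> /eqP; rewrite eqn_add2l => /eqP e'; case/eqP: ne; apply: val_inj.
  by move=> /eqP; rewrite eqn_add2l => /eqP e'; case/eqP: ne; apply: val_inj.
- by apply/orP; left; apply/eqP; congr Some; apply: val_inj.
Qed.

End Lasso.

(** * Logarithms and the two final bounds *)

Local Open Scope ring_scope.

Lemma ln2_gt0 (R : realType) : 0 < ln (2%:R : R).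
Proof. by rewrite ln_gt0 // ltr1n. Qed.

Lemma log2_ge (R : realType) m t : (2 ^ t <= m)%N -> t%:R <= log2 R m.
Proof.
move=> le; have m0 : (0 < m)%N by apply: leq_trans le; rewrite expn_gt0.
rewrite /log2 ler_pdivlMr ?ln2_gt0 // mulr_natl -lnXn ?ltr0n //.
by rewrite ler_ln ?posrE ?exprn_gt0 ?ltr0n // -natrX ler_nat.
Qed.

Lemma log2_le (R : realType) m t : (0 < m)%N -> (m <= 2 ^ t)%N -> log2 R m <= t%:R.
Proof.
move=> m0 le; rewrite /log2 ler_pdivrMr ?ln2_gt0 // mulr_natl -lnXn ?ltr0n //.
by rewrite ler_ln ?posrE ?exprn_gt0 ?ltr0n // -natrX ler_nat.
Qed.

Lemma log2_minn (R : realType) m n : (0 < m)%N -> (0 < n)%N ->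
  log2 R (minn m n) = Num.min (log2 R m) (log2 R n).
Proof.
have mono a b : (0 < a)%N -> (a <= b)%N -> log2 R a <= log2 R b.
  move=> a0 ab; rewrite /log2 ler_pM2r ?invr_gt0 ?ln2_gt0 //.
  by rewrite ler_ln ?posrE ?ltr0n ?ler_nat // (leq_trans a0).
move=> m0 n0; case/orP: (leq_total m n) => le.
  by rewrite (minn_idPl le) min_l ?mono.
by rewrite (minn_idPr le) min_r ?mono.
Qed.

Theorem corollary1 (R : realType) :
  (exists (C : R) (L : labeling_scheme) (A : algorithm),
     forall (k : nat) (I : gathering k),
       (1 <= k)%N -> (1 <= max_degree I)%N ->
       (label_length (L k I))%:R
         <= C * (1 + Num.min (log2 R (max_degree I)) (log2 R k)) /\
       exists t : nat,
         t%:R <= C * (minn (diameter I + k) (diameter I * max_degree I))%:R /\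
         gathers_in A (L k I) t)
  /\
  (exists c : R, 0 < c /\
     forall k Delta : nat, (1 <= k)%N -> (2 <= Delta)%N ->
     exists I : gathering k,
       max_degree I = Delta /\
       forall L : labeling_scheme,
         (exists (A : algorithm) (t : nat), gathers_in A (L k I) t) ->
         c * Num.min (log2 R Delta) (log2 R k) <= (label_length (L k I))%:R).
Proof.
split.
  have H k (I : gathering k) : exists lab : node I -> bitseq,
      (0 < k)%N -> (0 < max_degree I)%N ->
      (label_length lab <= 7 + (trunc_log 2 (minn (max_degree I) k)).*2)%N /\
      gathers_in relay_once lab (3 * minn (diameter I + k) (diameter I * max_degree I)).
    have [/andP[k0 d0]|no] := boolP ((0 < k)%N && (0 < max_degree I)%N).
      by have [lab labP] := exists_relay_labels k0 d0; exists lab.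
    by exists (fun=> [::]) => k0 d0; rewrite k0 d0 in no.
  (* The label bound [7 + 2 * trunc_log 2 M] is at most [7 * (1 + trunc_log 2 M)]; 7 also exceeds
     the factor 3 of the running time. *)
  exists 7%:R, (fun k I => projT1 (cid (H k I))), relay_once => k I k0 d0.
  case: cid => lab /= /(_ k0 d0)[lenP g]; split; last first.
    exists (3 * minn (diameter I + k) (diameter I * max_degree I))%N; split=> //.
    by rewrite -natrM ler_nat leq_mul2r orbT.
  rewrite -log2_minn //; set M := minn _ _ in lenP *.
  have tl : (trunc_log 2 M)%:R <= log2 R M.
    by apply: log2_ge; apply: trunc_logP; rewrite // /M leq_min d0.
  apply: (@le_trans _ _ (7 * (1 + trunc_log 2 M))%:R).
    by rewrite ler_nat; move: lenP; lia.
  by rewrite natrM ler_pM2l ?ltr0n // natrD lerD2l.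
exists 3%:R^-1; split=> [|k Delta k1 D2]; first by rewrite invr_gt0 ltr0n.
(* This choice gives the sink degree [n - p + 2 = Delta] and makes [k - p] equal to
   [minn Delta k - 2]. *)
pose n := maxn k Delta; pose p := (n - Delta + 2)%N.
have p2 : (2 <= p)%N by rewrite /p; lia.
have pn : (p <= n)%N by rewrite /p /n; lia.
have kn : (k <= n)%N by rewrite /n; lia.
exists (lasso_gathering p kn); split.
  by rewrite lasso_max_degree // /p /n; lia.
move=> L [A [t g]]; set len := label_length _.
have len0 : (1 < k)%N -> (0 < len)%N.
  by move=> k2; apply: lasso_label_neq0 g => //; rewrite /p /n; lia.
have leaves : (k - p <= 2 ^ len.+1)%N by apply: lasso_leaf_labels g.
rewrite -log2_minn //; last by lia.
rewrite ler_pdivrMl ?ltr0n // -natrM; apply: log2_le; first by lia.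
have [k2|k_le1] := ltnP 1 k; last by rewrite (leq_trans _ (expn_gt0 2 _)) //; lia.
have [l le] : exists l, len = l.+1 by case: len len0 {leaves} => [/(_ k2)//|l]; exists l.
have e1 : (1 <= 2 ^ l)%N by rewrite expn_gt0.
(* The leaves give [minn Delta k <= 2 ^ len.+1 + 2], which is at most [2 ^ (3 * len)] because [len]
   is positive; hence the constant 1/3. *)
have -> : (2 ^ (3 * len) = 8 * (2 ^ l) ^ 3)%N by rewrite le -!expnM -[8%N]/(2 ^ 3)%N -expnD; congr expn; lia.
have e3 : (2 ^ l <= (2 ^ l) ^ 3)%N by rewrite -{1}[(2 ^ l)%N]expn1 leq_pexp2l.
by move: leaves; rewrite le !expnS /p /n; lia.
Qed.
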